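(* For every integer $k \ge 1$ and every $\epsilon > 0$ there exists a binary matrix $\mathbf{A}$ (say of size $d \times n$) such that for every $\mathbf{P}_A \in \{0,1\}^{d \times k}$ whose columns are $k$ columns of $\mathbf{A}$ and every $\mathbf{Q} \in \{0,1\}^{k \times n}$, \[ \|\mathbf{A} - \mathbf{P}_A \mathbf{Q}\|_F^2 > \left(\frac{k}{2} + 1 + \frac{k}{2(2^k-1)} - \epsilon\right) \mathrm{OPT}_k, \] where $\mathrm{OPT}_k := \min_{\mathbf{U} \in \{0,1\}^{d\times k},\, \mathbf{V} \in \{0,1\}^{k \times n}} \|\mathbf{A} - \mathbf{U}\mathbf{V}\|_F^2$, and all matrix products are over $\mathrm{GF}(2)$.
   Context: All matrices are binary and all matrix operations are over the field $\mathrm{GF}(2)$. For a binary matrix $\mathbf{M}$, $\|\mathbf{M}\|_F^2$ is the number of entries of $\mathbf{M}$ equal to $1$. *)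

(* Defs.v *)
From mathcomp Require Import all_boot all_order all_algebra.

Set Implicit Arguments.
Unset Strict Implicit.
Unset Printing Implicit Defensive.

Import GRing.Theory.
Local Open Scope ring_scope.

(* ||M||_F^2 of a binary matrix. *)
Definition frob2 (d n : nat) (M : 'M['F_2]_(d, n)) : nat :=
  #|[set ij : 'I_d * 'I_n | M ij.1 ij.2 == 1]|.

Definition approx_err (d n k : nat) (A : 'M['F_2]_(d, n))
    (U : 'M['F_2]_(d, k)) (V : 'M['F_2]_(k, n)) : nat :=
  frob2 (A - U *m V).

(* The pair (0, 0) only witnesses that the finite type of factor pairs is
   inhabited. *)
Definition opt (k d n : nat) (A : 'M['F_2]_(d, n)) : nat :=
  let UV := [arg min_(X < ((0, 0) : 'M['F_2]_(d, k) * 'M['F_2]_(k, n)))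
               approx_err A X.1 X.2] in
  approx_err A UV.1 UV.2.

(* Repetitions are allowed among the columns chosen.  For k <= n this does not
   change which errors can be reached after optimizing over the second factor,
   and for 0 < n it guarantees that some P satisfies the predicate. *)
Definition columns_of (d n k : nat) (P : 'M['F_2]_(d, k))
    (A : 'M['F_2]_(d, n)) : Prop :=
  forall j : 'I_k, exists i : 'I_n, col j P = col i A.

(* Main.v *)
(* Let W list every nonzero vector of F_2^k as a column N times, and let A be W
   with each row repeated D times, on top of the identity matrix: the columns
   of A are well separated codewords, each with its own unit vector of noise.
   Discarding the noise gives OPT_k <= n = N (2^k - 1).  If P consists of the
   columns of A indexed by f, let B be the corresponding k x k submatrix of W.
   When B is invertible, a column w not in P is best written with coefficients
   B^-1 w, which costs 1 + |B^-1 w| noise entries; as w runs over the nonzero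
   vectors so does B^-1 w, whose average weight is k 2^(k-1) / (2^k - 1).  When
   B is singular, some nonzero v is out of its range, and the N copies of v
   cost at least D each. *)
Require Import Defs.
From mathcomp Require Import all_boot all_order all_algebra reals.
From mathcomp Require Import zify ring lra.

Set Implicit Arguments.
Unset Strict Implicit.
Unset Printing Implicit Defensive.

Import Order.TTheory GRing.Theory Num.Theory.
Local Open Scope ring_scope.

Definition wt (m : nat) (x : 'cV['F_2]_m) : nat := (\sum_i (x i 0 == 1)%R)%N.

Lemma F2_neq0 (x : 'F_2) : (x != 0) = (x == 1).
Proof. by case: x => [[|[|[]]]]. Qed.

Lemma frob2_sum_wt (d n : nat) (M : 'M['F_2]_(d, n)) :
  frob2 M = (\sum_j wt (col j M))%N.
Proof.
rewrite /frob2 -sum1_card big_mkcond /=.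
rewrite (eq_bigr (fun ij => (M ij.1 ij.2 == 1) : nat)) => [|ij _]; last first.
  by rewrite inE; case: (_ == _).
rewrite -(pair_bigA _ (fun i j => (M i j == 1) : nat)) exchange_big /=.
by apply: eq_bigr => j _; apply: eq_bigr => i _; rewrite mxE.
Qed.

Lemma wt_leq (m : nat) (x : 'cV['F_2]_m) : (wt x <= m)%N.
Proof.
rewrite -[leqRHS]card_ord -[leqRHS]sum1_card; apply: leq_sum => i _; exact: leq_b1.
Qed.

Lemma wt_gt0 (m : nat) (x : 'cV['F_2]_m) : x != 0 -> (0 < wt x)%N.
Proof.
apply: contraNT; rewrite -leqNgt leqn0 sum_nat_eq0 => /forallP x0.
apply/eqP/colP => i; rewrite mxE; apply/eqP.
by move: (x0 i); rewrite implyTb eqb0 -F2_neq0 negbK.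
Qed.

Lemma wt_col_mx (m1 m2 : nat) (x : 'cV['F_2]_m1) (y : 'cV['F_2]_m2) :
  wt (col_mx x y) = (wt x + wt y)%N.
Proof.
rewrite /wt big_split_ord /=.
by congr addn; apply: eq_bigr => i _; rewrite ?col_mxEu ?col_mxEd.
Qed.

(* Complementation pairs weights that add up to [k]. *)
Lemma sum_wt (k : nat) : (2 * \sum_(v : 'cV['F_2]_k) wt v = k * 2 ^ k)%N.
Proof.
rewrite mul2n -addnn {2}(reindex_inj (addrI (const_mx 1))) -big_split /=.
rewrite (eq_bigr (fun=> k)) ?sum_nat_const ?card_mx ?card_Fp ?muln1 1?mulnC //.
move=> v _; rewrite /wt -big_split /= -[RHS]card_ord -sum1_card.
by apply: eq_bigr => i _; rewrite !mxE; case: (v i 0) => [[|[|[]]]].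
Qed.

Definition repeat_rows (D m n : nat) (M : 'M['F_2]_(m, n)) :
    'M['F_2]_(#|{: 'I_D * 'I_m}|, n) :=
  rowsub (fun i => (enum_val i).2) M.

Lemma wt_repeat_rows (D m : nat) (x : 'cV['F_2]_m) :
  wt (repeat_rows D x) = (D * wt x)%N.
Proof.
rewrite /wt (eq_bigr (fun i => (x (@enum_val _ {:'I_D * 'I_m} i).2 0 == 1) : nat)); last first.
  by move=> i _; rewrite mxE.
rewrite -(big_enum_val (fun p => (x p.2 0 == 1) : nat)) /=.
rewrite -(pair_bigA _ (fun (_ : 'I_D) i => (x i 0 == 1) : nat)) /=.
by rewrite sum_nat_const card_ord.
Qed.

Definition gadget (D k n : nat) (W : 'M['F_2]_(k, n)) :=
  col_mx (repeat_rows D W) (1%:M : 'M['F_2]_n).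

Lemma opt_gadget (D k n : nat) (W : 'M['F_2]_(k, n)) :
  (opt k (gadget D W) <= n)%N.
Proof.
rewrite /opt; case: arg_minnP => // -[U V] _ /= minUV.
(* These factors reproduce every codeword exactly and leave only the identity block, one noise entry
   per column. *)
apply: leq_trans (minUV (col_mx (repeat_rows D 1%:M) 0, W) isT) _ => /=.
rewrite /approx_err frob2_sum_wt -[leqRHS]card_ord -[leqRHS]sum1_card.
apply: leq_sum => j _.
rewrite mul_col_mx mul0mx /repeat_rows mul_rowsub_mx mul1mx.
rewrite /gadget opp_col_mx add_col_mx subrr subr0 col_col_mx wt_col_mx.
rewrite /wt big1 ?add0n => [|i _]; last by rewrite !mxE.
rewrite (bigD1 j) //= big1 ?addn0 => [|i ij]; last by rewrite !mxE (negbTE ij).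
exact: leq_b1.
Qed.

(** Codeword error and noise error separate column by column, so each column of [Q] can be bounded
    on its own. *)
Lemma frob2_gadget (D k n m : nat) (W : 'M['F_2]_(k, n)) (f : 'I_m -> 'I_n)
    (Q : 'M['F_2]_(m, n)) :
  frob2 (gadget D W - colsub f (gadget D W) *m Q) =
  (\sum_j (D * wt (col j W - colsub f W *m col j Q) +
           wt (col j 1%:M - colsub f 1%:M *m col j Q)))%N.
Proof.
rewrite frob2_sum_wt; apply: eq_bigr => j _.
rewrite -wt_repeat_rows -wt_col_mx; congr wt.
have -> : colsub f (gadget D W) = col_mx (repeat_rows D (colsub f W)) (colsub f 1%:M).
  by apply/matrixP => i l; rewrite !mxE; case: split => i'; rewrite !mxE.
rewrite linearB /= col_col_mx !colE -mulmxA mul_col_mx opp_col_mx add_col_mx.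
by rewrite /repeat_rows linearB /= -!mul_rowsub_mx.
Qed.

(** The chosen unit vectors place the entries of [q] at distinct positions, all different from [j],
    so nothing cancels. *)
Lemma wt_unit_residual (n k : nat) (f : 'I_k -> 'I_n) (j : 'I_n) (q : 'cV['F_2]_k) :
  injective f -> j \notin codom f ->
  wt (col j 1%:M - colsub f 1%:M *m q) = (wt q).+1.
Proof.
move=> f_inj jf.
have resE i : (col j 1%:M - colsub f 1%:M *m q) i 0 =
              (i == j)%:R - \sum_(l | i == f l) q l 0.
  rewrite [LHS]mxE [in LHS]mxE [in RHS]big_mkcond; congr (_ + _); first by rewrite mxE.
  rewrite [LHS]mxE mxE; congr (- _); apply: eq_bigr => l _; rewrite !mxE.
  by case: eqP => _; rewrite ?mul1r ?mul0r.
rewrite /wt (bigD1 j) //= resE eqxx [X in _ - X]big_pred0 => [|l]; last first.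
  by apply: contraNF jf => /eqP ->; apply: codom_f.
rewrite subr0 eqxx add1n; congr S.
rewrite (bigID (mem (f @: setT))) /= [X in (_ + X)%N]big1 => [|i /andP[ij /negP iNf]].
  rewrite addn0 (eq_bigl (mem (f @: setT))) => [|i /=]; last first.
    by rewrite andb_idl // => /imsetP[l _ ->]; apply: contraNneq jf => <-; apply: codom_f.
  rewrite big_imset /=; last by move=> ? ? _ _ /f_inj.
  apply: eq_big => [l|l _]; first by rewrite inE.
  rewrite resE (big_pred1 l) => [|l' /=]; last by rewrite (inj_eq f_inj) eq_sym.
  have /negbTE -> : f l != j by apply: contraNneq jf => <-; apply: codom_f.
  by rewrite sub0r; case: (q l 0) => [[|[|[]]]].
rewrite resE (negbTE ij) [X in _ - X]big_pred0 ?subr0 // => l.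
by apply/negP => /eqP il; apply: iNf; rewrite il imset_f.
Qed.

(** A repeated column would make the determinant vanish. This supplies injectivity, which
    [columns_of] does not. *)
Lemma unitmx_colsub_inj (F : fieldType) (k n : nat) (W : 'M[F]_(k, n)) (f : 'I_k -> 'I_n) :
  colsub f W \in unitmx -> injective f.
Proof.
move=> Bu l l' ll'; apply/eqP; apply: contraLR Bu => neq.
rewrite unitmxE unitfE negbK -det_tr; apply/eqP.
by apply: (determinant_alternate neq) => i; rewrite !mxE ll'.
Qed.

(** A nonzero row [z] with [z *m B = 0] annihilates the range of [B], but not the basis vector at a
    nonzero coordinate of [z]. *)
Lemma singular_unreachable (F : fieldType) (k : nat) (B : 'M[F]_k) :
  B \notin unitmx -> exists2 v : 'cV[F]_k, v != 0 & forall q, v - B *m q != 0.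
Proof.
rewrite -row_free_unit -kermx_eq0 => /rowV0Pn[z /sub_kermxP zB z0].
have [s zs] : exists s, z 0 s != 0 by apply/rV0Pn.
have zv : z *m delta_mx s (0 : 'I_1) != 0.
  by rewrite -colE; apply: contraNneq zs => /colP/(_ 0); rewrite !mxE => ->.
exists (delta_mx s 0) => [|q]; first by apply: contraNneq zv => ->; rewrite mulmx0.
by apply: contraNneq zv => zq; rewrite -[X in _ == X](mulmx0 _ z) -zq mulmxBr mulmxA zB mul0mx subr0.
Qed.

Definition nonzero_set (k N : nat) := [set x : 'cV['F_2]_k * 'I_N | x.1 != 0].
Definition nonzero_mx (k N : nat) : 'M['F_2]_(k, #|nonzero_set k N|) :=
  \matrix_(s, j) (@enum_val _ (nonzero_set k N) j).1 s 0.

Lemma sum_nonzero_mx (k N : nat) (F : 'cV['F_2]_k -> nat) :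
  (\sum_j F (col j (nonzero_mx k N)) = N * \sum_(v | v != 0%R) F v)%N.
Proof.
rewrite (eq_bigr (fun j => F (@enum_val _ (nonzero_set k N) j).1)) => [|j _].
  rewrite -(big_enum_val (fun x => F x.1)) /=.
  rewrite (eq_bigl (fun x => (x.1 != 0) && true)) => [|x]; last by rewrite inE andbT.
  rewrite -(pair_big (fun v => v != 0) xpredT (fun v _ => F v)) /= big_distrr /=.
  by apply: eq_bigr => v _; rewrite sum_nat_const card_ord.
by congr F; apply/colP => s; rewrite !mxE.
Qed.

Lemma card_nonzero_set (k N : nat) : #|nonzero_set k N| = (N * (2 ^ k - 1))%N.
Proof.
have := sum_nonzero_mx N (fun _ : 'cV['F_2]_k => 1%N).
by rewrite sum1_card card_ord sum1_card cardC1 card_mx card_Fp // muln1 subn1.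
Qed.

(* The term [k * k.+1] compensates for the columns in the range of [f]. *)
Lemma gadget_lower_bound (k N : nat) (f : 'I_k -> 'I_#|nonzero_set k N|)
    (Q : 'M['F_2]_(k, #|nonzero_set k N|)) :
  (N * (k * 2 ^ k + 2 * (2 ^ k - 1)) <=
    2 * (frob2 (gadget (k.+1 * 2 ^ k) (nonzero_mx k N) -
                colsub f (gadget (k.+1 * 2 ^ k) (nonzero_mx k N)) *m Q) +
         k * k.+1))%N.
Proof.
rewrite frob2_gadget; set D := (k.+1 * _)%N.
set W := nonzero_mx k N; set B := colsub f W.
pose e j := (D * wt (col j W - B *m col j Q) +
             wt (col j 1%:M - colsub f 1%:M *m col j Q))%N.
rewrite [X in (2 * (X + _))%N](_ : _ = \sum_j e j)%N //.
have kD : (k < D)%N by rewrite leq_pmulr ?expn_gt0.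
have [Bu|/singular_unreachable[v v0 vB]] := boolP (B \in unitmx); last first.
  (* This suffices because [2 * D] exceeds [k * 2 ^ k + 2 * (2 ^ k - 1)]. *)
  have : (N * D <= \sum_j e j)%N.
    have -> : (N * D = \sum_j D * (col j W == v))%N.
      rewrite (sum_nonzero_mx N (fun x => D * (x == v))%N) (bigD1 v) //= eqxx.
      by rewrite big1 ?addn0 ?muln1 // => x /andP[_ /negbTE->]; rewrite muln0.
    apply: leq_sum => j _; rewrite /e; case: eqP => [->|]; last by rewrite muln0.
    by apply/leq_trans/leq_addr; rewrite leq_mul2l wt_gt0 ?orbT.
  rewrite /D; move: (2 ^ k)%N (\sum_j _)%N => T E; nia.
have f_inj : injective f by apply: unitmx_colsub_inj Bu.
(* Outside the range of [f], either the codeword is matched, which forces [col j Q] to be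
   [invmx B *m col j W], or the error is at least [D > k]. Inside, the added [k.+1] is already
   enough. *)
have step j : ((wt (invmx B *m col j W)).+1 <= e j + k.+1 * (j \in codom f))%N.
  have [jf|jf] := boolP (j \in codom f).
    by rewrite muln1; apply: leq_trans (leq_addl _ _); rewrite ltnS wt_leq.
  rewrite muln0 addn0 /e wt_unit_residual //.
  have [BQ|/wt_gt0 pos] := eqVneq (col j W - B *m col j Q) 0.
    by rewrite (subr0_eq BQ) mulKmx // leq_addl.
  apply: leq_trans (leq_addr _ _); apply: leq_trans (leq_pmulr D pos).
  by apply: leq_trans kD; rewrite ltnS wt_leq.
have codom_card : (\sum_j (j \in codom f) = k)%N.
  rewrite -[RHS]card_ord -(card_codom f_inj) -[RHS]sum1_card [RHS]big_mkcond /=.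
  by apply: eq_bigr => j _; case: (j \in _).
have : (\sum_j (wt (invmx B *m col j W)).+1 <= \sum_j e j + k.+1 * k)%N.
  by rewrite -[X in (_ + _ * X)%N]codom_card big_distrr -big_split leq_sum.
rewrite (sum_nonzero_mx N (fun x => (wt (invmx B *m x)).+1)).
have -> : (\sum_(v | v != 0%R) (wt (invmx B *m v)).+1 =
           \sum_(v : 'cV['F_2]_k | v != 0%R) (wt v + 1))%N.
  (* Multiplication by [invmx B] permutes the nonzero vectors. *)
  rewrite [RHS](reindex_inj (can_inj (mulKVmx Bu))) /=.
  apply: eq_big => v; last by rewrite addn1.
  by rewrite -[X in _ = ~~ (_ == X)](mulmx0 _ (invmx B)) (can_eq (mulKVmx Bu)).
rewrite big_split /= sum1_card cardC1 card_mx card_Fp // muln1.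
have := sum_wt k; rewrite (bigD1 0) //= [X in (X + _)%N](_ : _ = 0)%N; last first.
  by rewrite /wt big1 // => i _; rewrite mxE.
move: (2 ^ k)%N (\sum_j _)%N (\sum_(v | _) _)%N => T E S; nia.
Qed.

Theorem theorem2 (R : realType) (k : nat) (hk : (1 <= k)%N)
    (eps : R) (heps : 0 < eps) :
  exists (d n : nat) (A : 'M['F_2]_(d, n)),
    [/\ (0 < d)%N, (0 < n)%N &
      forall (P : 'M['F_2]_(d, k)) (Q : 'M['F_2]_(k, n)),
        columns_of P A ->
        (frob2 (A - P *m Q))%:R >
          (k%:R / 2 + 1 + k%:R / (2 * (2 ^+ k - 1)) - eps) * (opt k A)%:R].
Proof.
(* The first summand makes [eps * N] exceed the loss [k * k.+1]; the other two give [N > k * k.+1],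
   hence a positive error. *)
pose N := ((Num.bound (eps^-1 * (k * k.+1)%:R)) + k * k.+1 + 1)%N.
have k2 : (1 < 2 ^ k)%N by rewrite -{1}(expn0 2) ltn_exp2l.
have n0 : (0 < #|nonzero_set k N|)%N by rewrite card_nonzero_set /N muln_gt0 subn_gt0 addn1.
exists _, _, (gadget (k.+1 * 2 ^ k) (nonzero_mx k N)); split=> //.
  by rewrite addn_gt0 n0 orbT.
move=> P Q PA.
have [f fP] : exists f, P = colsub f (gadget (k.+1 * 2 ^ k) (nonzero_mx k N)).
  have /fin_all_exists[f fP] := PA; exists f.
  by apply/matrixP => i j; have /colP/(_ i) := fP j; rewrite !mxE.
have := @gadget_lower_bound k N f Q; rewrite /= -fP.
have := @opt_gadget (k.+1 * 2 ^ k) _ _ (nonzero_mx k N).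
set E := frob2 _; set o := opt _ _; rewrite card_nonzero_set.
set M := (2 ^ k - 1)%N => oM EM.
have N1 : (k * k.+1)%:R < eps * N%:R.
  rewrite mulrC -ltr_pdivrMr // mulrC.
  apply: lt_le_trans (archi_boundP _) _; first by rewrite mulr_ge0 // invr_ge0 ltW.
  by rewrite ler_nat /N -addnA leq_addr.
have N2 : (k * k.+1 < N)%N by rewrite /N; lia.
have M1 : (1 <= M)%N by rewrite subn_gt0.
have -> : 2 ^+ k - 1 = M%:R :> R by rewrite /M natrB ?natrX // ltnW.
have T2 : (2 ^ k = M + 1)%N by rewrite /M subnK // ltnW.
rewrite T2 in EM.
have E0 : (0 < E)%N by move: EM N2; clear -M1; nia.
set c := (X in X - eps).
(* With denominators cleared, [EM] reads [c * N * M <= E + k * k.+1], and the loss is below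
   [eps * N * M]. *)
have cM : c * M%:R * 2 = (k * (M + 1) + 2 * M)%:R.
  have : M%:R != 0 :> R by rewrite pnatr_eq0 -lt0n.
  by rewrite /c !natrD !natrM natrD => M0; field.
(* The upper bound on [o] can be multiplied by [c - eps] only if this is nonnegative; otherwise [E0]
   suffices. *)
have [ceps|ceps] := leP 0 (c - eps); last first.
  by apply: le_lt_trans (_ : 0 < E%:R); rewrite ?ltr0n // nmulr_rle0.
apply: (le_lt_trans (ler_wpM2l ceps (_ : o%:R <= (N * M)%:R))); first by rewrite ler_nat.
have : (N * (k * (M + 1) + 2 * M))%:R <= (2 * (E + k * k.+1))%:R :> R by rewrite ler_nat.
have : eps * N%:R * 1 <= eps * N%:R * M%:R.
  by rewrite ler_wpM2l ?ler1n // mulr_ge0 // ltW.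
move: N1; rewrite [(N * (_ + _))%:R]natrM -cM !natrM natrD !natrM.
by lra.
Qed.
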